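(* The following relations hold in $U_q(\mathfrak{sl}_2)$: \begin{align*} q^3 \nu_x^2\nu_y-(q+q^{-1})\nu_x\nu_y\nu_x + q^{-3}\nu_y\nu_x^2 &= (q^2-q^{-2})(q-q^{-1})\nu_x,\\ q^3 \nu_y^2\nu_z-(q+q^{-1})\nu_y\nu_z\nu_y + q^{-3}\nu_z\nu_y^2 &= (q^2-q^{-2})(q-q^{-1})\nu_y,\\ q^3 \nu_z^2\nu_x-(q+q^{-1})\nu_z\nu_x\nu_z + q^{-3}\nu_x\nu_z^2 &= (q^2-q^{-2})(q-q^{-1})\nu_z,\\ q^{-3} \nu_y^2\nu_x-(q+q^{-1})\nu_y\nu_x\nu_y + q^{3}\nu_x\nu_y^2 &= (q^2-q^{-2})(q-q^{-1})\nu_y,\\ q^{-3} \nu_z^2\nu_y-(q+q^{-1})\nu_z\nu_y\nu_z + q^{3}\nu_y\nu_z^2 &= (q^2-q^{-2})(q-q^{-1})\nu_z,\\ q^{-3} \nu_x^2\nu_z-(q+q^{-1})\nu_x\nu_z\nu_x + q^{3}\nu_z\nu_x^2 &= (q^2-q^{-2})(q-q^{-1})\nu_x. \end{align*}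
   Context: $\mathbb K$ is a field and $q$ is a nonzero scalar in $\mathbb K$ with $q^2\neq 1$. $U_q(\mathfrak{sl}_2)$ is the unital associative $\mathbb K$-algebra with generators $x,y,y^{-1},z$ and relations $yy^{-1}=y^{-1}y=1$, $\frac{qxy-q^{-1}yx}{q-q^{-1}}=1$, $\frac{qyz-q^{-1}zy}{q-q^{-1}}=1$, $\frac{qzx-q^{-1}xz}{q-q^{-1}}=1$. In $U_q(\mathfrak{sl}_2)$: $\nu_x=q(1-yz)=q^{-1}(1-zy)$, $\nu_y=q(1-zx)=q^{-1}(1-xz)$, $\nu_z=q(1-xy)=q^{-1}(1-yx)$. *)

(* Defs.v *)
From HB Require Import structures.
From mathcomp Require Import all_boot all_order all_algebra.
From mathcomp Require Import boolp.
From mathcomp Require Import monalg.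

Set Implicit Arguments.
Unset Strict Implicit.
Unset Printing Implicit Defensive.

Import GRing.Theory.
Local Open Scope ring_scope.
Local Open Scope quotient_scope.

Section FreeAlgebra.
Variables (K : comNzRingType) (I : choiceType).

Definition freealg : Type := {malg K[{fmonom I}]}.

HB.instance Definition _ := GRing.Lalgebra.on freealg.

Fact freealg_scalerAr (c : K) (u v : freealg) : c *: (u * v) = u * (c *: v).
Proof.
have cC (w : {malg K[{fmonom I}]}) : c *: w = w * c%:MP.
  rewrite -mul_malgC !malgM_def fgmulUg fgmulgU.
  by apply: eq_bigr => k _; rewrite mulrC mulm1 mul1m.
by rewrite [LHS](cC (u * v)) -mulrA -[v * _](cC v).
Qed.

HB.instance Definition _ :=
  GRing.Lalgebra_isAlgebra.Build K freealg freealg_scalerAr.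

Definition freegen (i : I) : freealg := << fmu i >>.

End FreeAlgebra.

(* The library only equips quotients of commutative rings with a product, so
   the quotient by a two-sided ideal is built here on top of the additive
   quotient of ring_quotient. *)
Section PresentedAlgebra.
Variables (K : comNzRingType) (A : algType K) (S : {pred A}).

Inductive gen_ideal : A -> Prop :=
| gen_ideal_gen a of a \in S : gen_ideal a
| gen_ideal0 : gen_ideal 0
| gen_idealB a b of gen_ideal a & gen_ideal b : gen_ideal (a - b)
| gen_idealMl a b of gen_ideal b : gen_ideal (a * b)
| gen_idealMr a b of gen_ideal a : gen_ideal (a * b).

Definition gen_idealb : {pred A} := fun a => `[< gen_ideal a >].

Fact gen_idealb_zmod_closed : zmod_closed gen_idealb.
Proof.
split; first exact/asboolP/gen_ideal0.
by move=> a b /asboolP Ia /asboolP Ib; apply/asboolP/gen_idealB.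
Qed.

HB.instance Definition _ :=
  GRing.isZmodClosed.Build A gen_idealb gen_idealb_zmod_closed.

(* algType structures are nonzero in the library, hence the properness proof. *)
Definition presalg of ~ gen_ideal 1 : Type := Quotient.quot gen_idealb.

Section Structure.
Hypothesis proper : ~ gen_ideal 1.
Local Notation Q := (presalg proper).

HB.instance Definition _ := GRing.Zmodule.on Q.

Definition presalg_pi (a : A) : Q := \pi_(Quotient.quot gen_idealb) a.

Lemma presalg_piP (a b : A) :
  presalg_pi a = presalg_pi b <-> gen_ideal (a - b).
Proof.
have -> : gen_ideal (a - b) <-> (a - b) \in gen_idealb.
  by split=> /asboolP.
by rewrite Quotient.idealrBE; split=> [e|/eqP //]; apply/eqP.
Qed.

Fact presalg_pi_is_zmod_morphism : zmod_morphism presalg_pi.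
Proof. exact: (raddfB \pi_(Quotient.quot gen_idealb)). Qed.

Let repr_ (u : Q) : A := repr (u : Quotient.quot gen_idealb).

Let reprK_ u : presalg_pi (repr_ u) = u. Proof. exact: reprK. Qed.

Let gen_ideal_repr a : gen_ideal (repr_ (presalg_pi a) - a).
Proof. by apply/presalg_piP; rewrite reprK_. Qed.

Let pi_ind (P : Q -> Prop) : (forall a, P (presalg_pi a)) -> forall u, P u.
Proof. by move=> Ppi u; rewrite -[u]reprK_. Qed.

Definition presalg_one : Q := presalg_pi 1.
Definition presalg_mul (u v : Q) : Q := presalg_pi (repr_ u * repr_ v).
Definition presalg_scale (c : K) (u : Q) : Q := presalg_pi (c *: repr_ u).

Let piD : {morph presalg_pi : a b / a + b}.
Proof.
move=> a b; rewrite -[b in LHS]opprK presalg_pi_is_zmod_morphism.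
by rewrite -[- b]add0r presalg_pi_is_zmod_morphism -[0]subr0
           presalg_pi_is_zmod_morphism subrr sub0r opprK.
Qed.

Let piM a b : presalg_pi (a * b) = presalg_mul (presalg_pi a) (presalg_pi b).
Proof.
apply/esym/presalg_piP.
set a' := repr_ _; set b' := repr_ _.
have -> : a' * b' - a * b = a' * (b' - b) - (- ((a' - a) * b)).
  by rewrite opprK mulrBr mulrBl addrA subrK.
apply: gen_idealB; first exact/gen_idealMl/gen_ideal_repr.
by rewrite -mulN1r; apply/gen_idealMl/gen_idealMr/gen_ideal_repr.
Qed.

Let piZ c a : presalg_pi (c *: a) = presalg_scale c (presalg_pi a).
Proof.
apply/esym/presalg_piP; rewrite -scalerBr -[_ - a]mul1r scalerAl.
exact/gen_idealMl/gen_ideal_repr.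
Qed.

Fact presalg_mulA : associative presalg_mul.
Proof.
elim/pi_ind=> a; elim/pi_ind=> b; elim/pi_ind=> c.
by rewrite -!piM mulrA.
Qed.

Fact presalg_mul1 : left_id presalg_one presalg_mul.
Proof. by elim/pi_ind=> a; rewrite -piM mul1r. Qed.

Fact presalg_mulr1 : right_id presalg_one presalg_mul.
Proof. by elim/pi_ind=> a; rewrite -piM mulr1. Qed.

Fact presalg_mulDl : left_distributive presalg_mul +%R.
Proof.
elim/pi_ind=> a; elim/pi_ind=> b; elim/pi_ind=> c.
by rewrite -piD -!piM mulrDl piD.
Qed.

Fact presalg_mulDr : right_distributive presalg_mul +%R.
Proof.
elim/pi_ind=> a; elim/pi_ind=> b; elim/pi_ind=> c.
by rewrite -piD -!piM mulrDr piD.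
Qed.

Fact presalg_one_neq0 : presalg_one != 0.
Proof.
apply/eqP=> /esym one0; apply: proper; rewrite -[1]subr0.
by apply/presalg_piP; rewrite -[LHS]one0 -[0 in RHS](subrr 1)
  presalg_pi_is_zmod_morphism subrr.
Qed.

HB.instance Definition _ := GRing.Zmodule_isNzRing.Build Q
  presalg_mulA presalg_mul1 presalg_mulr1 presalg_mulDl presalg_mulDr
  presalg_one_neq0.

Fact presalg_scalerA c d (u : Q) :
  presalg_scale c (presalg_scale d u) = presalg_scale (c * d) u.
Proof. by elim/pi_ind: u => a; rewrite -!piZ scalerA. Qed.

Fact presalg_scale1r : left_id 1 presalg_scale.
Proof. by elim/pi_ind=> a; rewrite -piZ scale1r. Qed.

Fact presalg_scalerDr : right_distributive presalg_scale +%R.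
Proof.
move=> c; elim/pi_ind=> a; elim/pi_ind=> b.
by rewrite -piD -!piZ scalerDr piD.
Qed.

Fact presalg_scalerDl (u : Q) :
  {morph presalg_scale^~ u : c d / c + d}.
Proof. by move=> c d; elim/pi_ind: u => a; rewrite -!piZ scalerDl piD. Qed.

HB.instance Definition _ := GRing.Zmodule_isLmodule.Build K Q
  presalg_scalerA presalg_scale1r presalg_scalerDr presalg_scalerDl.

Fact presalg_scalerAl c (u v : Q) : c *: (u * v) = (c *: u) * v.
Proof.
elim/pi_ind: u => a; elim/pi_ind: v => b.
by rewrite /GRing.scale /GRing.mul /= -!(piM, piZ) scalerAl.
Qed.

HB.instance Definition _ :=
  GRing.Lmodule_isLalgebra.Build K Q presalg_scalerAl.

Fact presalg_scalerAr c (u v : Q) : c *: (u * v) = u * (c *: v).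
Proof.
elim/pi_ind: u => a; elim/pi_ind: v => b.
by rewrite /GRing.scale /GRing.mul /= -!(piM, piZ) scalerAr.
Qed.

HB.instance Definition _ :=
  GRing.Lalgebra_isAlgebra.Build K Q presalg_scalerAr.

HB.instance Definition _ :=
  GRing.isZmodMorphism.Build A Q presalg_pi presalg_pi_is_zmod_morphism.

Fact presalg_pi_is_monoid_morphism : monoid_morphism presalg_pi.
Proof. by split. Qed.

HB.instance Definition _ :=
  GRing.isMonoidMorphism.Build A Q presalg_pi presalg_pi_is_monoid_morphism.

Fact presalg_pi_is_scalable : scalable presalg_pi.
Proof. by move=> c a; rewrite piZ. Qed.

HB.instance Definition _ :=
  GRing.isScalable.Build K A Q *:%R presalg_pi presalg_pi_is_scalable.

Lemma presalg_pi_gen a : a \in S -> presalg_pi a = 0.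
Proof.
move=> Sa; rewrite -(raddf0 presalg_pi); apply/presalg_piP.
by rewrite subr0; apply: gen_ideal_gen.
Qed.

End Structure.
End PresentedAlgebra.

(* The character of the free algebra sending every generator to 1 kills the
   relators of U_q(sl_2), which therefore generate a proper ideal. *)
Section Augmentation.
Variables (K : comNzRingType) (I : choiceType).

Definition one_monom (_ : {fmonom I}) : K := 1.

Fact one_monom_mmorphism : mmorphism one_monom.
Proof. by split=> // u v; rewrite /one_monom mulr1. Qed.

HB.instance Definition _ :=
  monalg.isMultiplicative.Build {fmonom I} K one_monom one_monom_mmorphism.

Definition augmentation : freealg K I -> K := mmap idfun one_monom.

HB.instance Definition _ := GRing.RMorphism.on augmentation.
HB.instance Definition _ :=
  GRing.isScalable.Build K (freealg K I) K *%R augmentation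
    (@mmap_is_linear _ _ one_monom).

Lemma augmentation_gen i : augmentation (freegen K i) = 1.
Proof. by rewrite /augmentation mmapU mulr1. Qed.

End Augmentation.

Section Relators.
Variables (K : fieldType) (q : K) (A : algType K).

Definition uqsl2_relators (x y yV z : A) : seq A :=
  [:: y * yV - 1;
      yV * y - 1;
      (q - q^-1)^-1 *: (q *: (x * y) - q^-1 *: (y * x)) - 1;
      (q - q^-1)^-1 *: (q *: (y * z) - q^-1 *: (z * y)) - 1;
      (q - q^-1)^-1 *: (q *: (z * x) - q^-1 *: (x * z)) - 1].

Hypotheses (q0 : q != 0) (q2 : q ^+ 2 != 1).

Fact uqsl2_qBqV : q - q^-1 != 0.
Proof.
apply: contra q2; rewrite subr_eq0 => /eqP qV.
by rewrite expr2 [X in _ * X]qV mulfV.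
Qed.

Lemma uqsl2_relators_character (f : {lrmorphism A -> K | *%R}) x y yV z :
    f x = 1 -> f y = 1 -> f yV = 1 -> f z = 1 ->
  {in uqsl2_relators x y yV z, forall a, f a = 0}.
Proof.
move=> fx fy fyV fz.
have fB : {morph f : u v / u - v} by exact: rmorphB.
have fM : {morph f : u v / u * v} by exact: rmorphM.
have fZ c u : f (c *: u) = c * f u by exact: linearZ.
have f1 : f 1 = 1 by exact: rmorph1.
have qrel u v : f u = 1 -> f v = 1 ->
    f ((q - q^-1)^-1 *: (q *: (u * v) - q^-1 *: (v * u)) - 1) = 0.
  move=> u1 v1; rewrite fB fZ fB !fZ !fM f1 u1 v1.
  by rewrite !mulr1 mulVf ?uqsl2_qBqV // subrr.
have rel u v : f u = 1 -> f v = 1 -> f (u * v - 1) = 0.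
  by move=> u1 v1; rewrite fB fM f1 u1 v1 mulr1 subrr.
move=> a; rewrite !inE.
by case/or4P=> [||| /orP[]] /eqP->; first [exact: rel | exact: qrel].
Qed.

Lemma uqsl2_relators_proper (f : {lrmorphism A -> K | *%R}) x y yV z :
    f x = 1 -> f y = 1 -> f yV = 1 -> f z = 1 ->
  ~ gen_ideal (mem (uqsl2_relators x y yV z)) 1.
Proof.
move=> fx fy fyV fz I1.
have rel0 := uqsl2_relators_character fx fy fyV fz.
suff /eqP : f 1 = 0 by rewrite rmorph1 oner_eq0.
elim: I1 => [a /rel0 //||a b _ a0 _ b0|a b _ b0|a b _ a0].
- exact: raddf0.
- by rewrite raddfB /= a0 b0 subrr.
- by rewrite rmorphM /= b0 mulr0.
- by rewrite rmorphM /= a0 mul0r.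
Qed.

End Relators.

Lemma map_uqsl2_relators (K : fieldType) (q : K) (A B : algType K)
    (f : {lrmorphism A -> B}) x y yV z :
  map f (uqsl2_relators q x y yV z) =
    uqsl2_relators q (f x) (f y) (f yV) (f z).
Proof.
have fB : {morph f : u v / u - v} by exact: rmorphB.
have fM : {morph f : u v / u * v} by exact: rmorphM.
have fZ c u : f (c *: u) = c *: f u by exact: linearZ.
have f1 : f 1 = 1 by exact: rmorph1.
by rewrite /= !(fB, fZ, fM, f1).
Qed.

Lemma uqsl2_relators_eq0 (K : fieldType) (q : K) (A : algType K)
    (x y yV z : A) :
    {in uqsl2_relators q x y yV z, forall a, a = 0} ->
  [/\ y * yV = 1, yV * y = 1,
      (q - q^-1)^-1 *: (q *: (x * y) - q^-1 *: (y * x)) = 1,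
      (q - q^-1)^-1 *: (q *: (y * z) - q^-1 *: (z * y)) = 1 &
      (q - q^-1)^-1 *: (q *: (z * x) - q^-1 *: (x * z)) = 1].
Proof.
move=> rel0.
have rel1 a : a - 1 \in uqsl2_relators q x y yV z -> a = 1.
  by move/rel0/eqP; rewrite subr_eq0 => /eqP.
by split; apply: rel1; rewrite !in_cons eqxx ?orbT.
Qed.

Lemma presalg_uqsl2_relators (K : fieldType) (q : K) (A : algType K)
    (x y yV z : A) (proper : ~ gen_ideal (mem (uqsl2_relators q x y yV z)) 1)
    (pi := presalg_pi proper) :
  {in uqsl2_relators q (pi x) (pi y) (pi yV) (pi z), forall a, a = 0}.
Proof.
rewrite -(map_uqsl2_relators q pi) => _ /mapP[a ra ->].
exact: presalg_pi_gen.
Qed.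

Lemma uqsl2_nu_alt (K : fieldType) (q : K) (A : algType K) (u v : A) :
    q != 0 -> q ^+ 2 != 1 ->
    (q - q^-1)^-1 *: (q *: (u * v) - q^-1 *: (v * u)) = 1 ->
  q *: (1 - u * v) = q^-1 *: (1 - v * u).
Proof.
move=> q0 q2 /(congr1 (GRing.scale (q - q^-1))).
rewrite scalerA mulfV ?uqsl2_qBqV // scale1r scalerBl => uv.
apply/eqP; rewrite -subr_eq0 !scalerBr opprB [X in _ + X]addrC addrACA -uv.
by rewrite [X in _ + X]addrC -[X in X + _]opprB addNr.
Qed.

(* Generators 0, 1, 2, 3 of the free algebra stand for x, y, y^-1, z. *)
Section Uqsl2.
Variables (K : fieldType) (q : K).

Definition uqsl2_ideal : freealg K 'I_4 -> Prop :=
  gen_ideal (mem (uqsl2_relators q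
    (freegen K (inord 0)) (freegen K (inord 1))
    (freegen K (inord 2)) (freegen K (inord 3)))).

Hypotheses (q0 : q != 0) (q2 : q ^+ 2 != 1).

Fact uqsl2_proper : ~ uqsl2_ideal 1.
Proof.
apply: (@uqsl2_relators_proper K q (freealg K 'I_4) q0 q2
  (@augmentation K 'I_4)); exact: augmentation_gen.
Qed.

Definition uqsl2 : algType K := presalg uqsl2_proper.

Definition uq_x : uqsl2 := presalg_pi uqsl2_proper (freegen K (inord 0)).
Definition uq_y : uqsl2 := presalg_pi uqsl2_proper (freegen K (inord 1)).
Definition uq_yV : uqsl2 := presalg_pi uqsl2_proper (freegen K (inord 2)).
Definition uq_z : uqsl2 := presalg_pi uqsl2_proper (freegen K (inord 3)).

Lemma uqsl2_relations :
  [/\ uq_y * uq_yV = 1, uq_yV * uq_y = 1,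
      (q - q^-1)^-1 *: (q *: (uq_x * uq_y) - q^-1 *: (uq_y * uq_x)) = 1,
      (q - q^-1)^-1 *: (q *: (uq_y * uq_z) - q^-1 *: (uq_z * uq_y)) = 1 &
      (q - q^-1)^-1 *: (q *: (uq_z * uq_x) - q^-1 *: (uq_x * uq_z)) = 1].
Proof.
apply: (@uqsl2_relators_eq0 K q uqsl2).
exact: (@presalg_uqsl2_relators K q (freealg K 'I_4) _ _ _ _ uqsl2_proper).
Qed.

Definition nu_x : uqsl2 := q *: (1 - uq_y * uq_z).
Definition nu_y : uqsl2 := q *: (1 - uq_z * uq_x).
Definition nu_z : uqsl2 := q *: (1 - uq_x * uq_y).

Lemma nu_xE : nu_x = q^-1 *: (1 - uq_z * uq_y).
Proof. by case: uqsl2_relations => _ _ _ + _; apply: uqsl2_nu_alt. Qed.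

Lemma nu_yE : nu_y = q^-1 *: (1 - uq_x * uq_z).
Proof. by case: uqsl2_relations => _ _ _ _; apply: uqsl2_nu_alt. Qed.

Lemma nu_zE : nu_z = q^-1 *: (1 - uq_y * uq_x).
Proof. by case: uqsl2_relations => _ _ + _ _; apply: uqsl2_nu_alt. Qed.

End Uqsl2.

(* Main.v *)
Require Import Defs.
From mathcomp Require Import all_boot all_order all_algebra.
From mathcomp Require Import ring.
Import GRing.Theory.
Local Open Scope ring_scope.

(** Write [nu u v] for [q (1 - u v)], so that the three elements of the
    statement are [nu y z], [nu z x] and [nu x y].  When [(u, v)] satisfies the
    defining relation [q u v - q^-1 v u = q - q^-1], also
    [nu u v = q^-1 (1 - v u)].  Having both expressions makes [nu u v]
    commute with [v] up to a power of [q]: both [v (u v)] and [(v u) v] are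
    [v u v], hence [v (nu u v) = q^2 (nu u v) v], and symmetrically
    [(nu u v) u = q^2 u (nu u v)].

    The two expressions also give the quadratic relation
    [q a b - q^-1 b a = (q - q^-1) (1 - z^2)] for [a = nu y z] and
    [b = nu z x] ([nu_qcommutator]).  Call its left-hand side [N].  The cubic
    expressions are then twisted commutators of [N]:
<<
    q^3 a^2 b  - (q + q^-1) a b a + q^-3 b a^2 = q^2 a N - q^-2 N a
    q^-3 b^2 a - (q + q^-1) b a b + q^3 a b^2  = q^2 N b - q^-2 b N
>>
    The weights [q^2], [q^-2] are such that the contribution of [z^2] to [N]
    cancels, because [z^2 a = q^4 a z^2] and [b z^2 = q^4 z^2 b]; the
    contribution of [1] is the right-hand side ([cubic_relations]).

    The relations between [x], [y], [z] are invariant under the cyclic shift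
    [x -> y -> z -> x], whose three powers turn these two identities into
    all six. *)

Section QCommutation.

Set Implicit Arguments.
Unset Strict Implicit.

Variables (K : fieldType) (q : K) (A : algType K).
Hypotheses (q0 : q != 0) (q2 : q ^+ 2 != 1).

Definition qweyl (u v : A) : Prop :=
  (q - q^-1)^-1 *: (q *: (u * v) - q^-1 *: (v * u)) = 1.

Definition nu (u v : A) : A := q *: (1 - u * v).

Lemma qweylE u v : qweyl u v ->
  q *: (u * v) - q^-1 *: (v * u) = (q - q^-1) *: 1.
Proof.
by move=> <-; rewrite scalerA mulfV ?scale1r // uqsl2_qBqV.
Qed.

Lemma nu_sym u v : qweyl u v -> nu u v = q^-1 *: (1 - v * u).
Proof. exact: uqsl2_nu_alt. Qed.

(** Both sides are [q (v - v u v)]: the left one by the definition of [nu u v],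
    the right one by its other expression [q^-1 (1 - v u)]. *)
Lemma nu_qcommr u v : qweyl u v -> v * nu u v = q ^+ 2 *: (nu u v * v).
Proof.
move=> uv; rewrite [in RHS](nu_sym uv) /nu -!scalerAl -scalerAr scalerA.
by rewrite mulrBr mulrBl mulr1 mul1r mulrA expr2 mulfK.
Qed.

Lemma nu_qcomml u v : qweyl u v -> nu u v * u = q ^+ 2 *: (u * nu u v).
Proof.
move=> uv; rewrite [in RHS](nu_sym uv) /nu -!scalerAl -scalerAr scalerA.
by rewrite mulrBr mulrBl mulr1 mul1r mulrA expr2 mulfK.
Qed.

Lemma nu_qcommr2 u v : qweyl u v ->
  v ^+ 2 * nu u v = q ^+ 4 *: (nu u v * v ^+ 2).
Proof.
move=> uv; rewrite !expr2 -mulrA nu_qcommr // -scalerAr.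
by rewrite [in LHS]mulrA nu_qcommr // -scalerAl scalerA -exprD mulrA.
Qed.

Lemma nu_qcomml2 u v : qweyl u v ->
  nu u v * u ^+ 2 = q ^+ 4 *: (u ^+ 2 * nu u v).
Proof.
move=> uv; rewrite !expr2 mulrA nu_qcomml // -scalerAl.
by rewrite -[in LHS]mulrA nu_qcomml // -scalerAr scalerA -exprD mulrA.
Qed.

(** Expanding the factor [nu y z] of each product in the form that carries the
    scalar cancelling the coefficient in front of it leaves
    [b (y z) - (z y) b] with [b = nu z x].  Expanding [b] in its two forms
    turns this into [N y z - z (N x y) z], where
    [N u v = q u v - q^-1 v u] is the scalar of the defining relations. *)
Lemma nu_qcommutator x y z : qweyl x y -> qweyl y z -> qweyl z x ->
  q *: (nu y z * nu z x) - q^-1 *: (nu z x * nu y z)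
    = (q - q^-1) *: (1 - z ^+ 2).
Proof.
move=> xy yz zx.
have -> : q *: (nu y z * nu z x) = nu z x - z * y * nu z x.
  by rewrite (nu_sym yz) -scalerAl scalerA mulfV // scale1r mulrBl mul1r.
have -> : q^-1 *: (nu z x * nu y z) = nu z x - nu z x * (y * z).
  by rewrite [nu y z]/nu -scalerAr scalerA mulVf // scale1r mulrBr mulr1.
rewrite opprB addrC addrA subrK.
have -> : nu z x * (y * z) = q *: (y * z) - z * (q *: (x * y)) * z.
  by rewrite /nu -scalerAl mulrBl mul1r scalerBr -scalerAr -scalerAl !mulrA.
have -> : z * y * nu z x = q^-1 *: (z * y) - z * (q^-1 *: (y * x)) * z.
  rewrite (nu_sym zx) -scalerAr mulrBr mulr1 scalerBr -scalerAr -scalerAl.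
  by rewrite !mulrA.
(* The middle terms combine to [- z (N x y) z] with [N x y] scalar. *)
have zNz : z * (q *: (x * y)) * z - z * (q^-1 *: (y * x)) * z
    = (q - q^-1) *: z ^+ 2.
  by rewrite -mulrBl -mulrBr qweylE // -scalerAr mulr1 -scalerAl expr2.
rewrite scalerBr -(qweylE yz) -zNz !opprB addrACA [RHS]addrACA.
by congr (_ + _); rewrite addrC.
Qed.

(** With [N = q a b - q^-1 b a], the left-hand sides are [q^2 a N - q^-2 N a]
    and [q^2 N b - q^-2 b N].  The hypotheses on [w] make its contribution
    through [N = (q - q^-1) (1 - w)] cancel. *)
Lemma cubic_relations (a b w : A) :
    q *: (a * b) - q^-1 *: (b * a) = (q - q^-1) *: (1 - w) ->
    w * a = q ^+ 4 *: (a * w) -> b * w = q ^+ 4 *: (w * b) ->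
  let c := (q ^+ 2 - q ^- 2) * (q - q^-1) in
  (q ^+ 3 *: (a ^+ 2 * b) - (q + q^-1) *: (a * b * a)
     + q ^- 3 *: (b * a ^+ 2) = c *: a) /\
  (q ^- 3 *: (b ^+ 2 * a) - (q + q^-1) *: (b * a * b)
     + q ^+ 3 *: (a * b ^+ 2) = c *: b).
Proof.
move=> defN wa bw c.
have qV2q4 : q ^- 2 * q ^+ 4 = q ^+ 2 by field.
have qV2q : q ^- 2 * q = q^-1 by field.
have q2qV : q ^+ 2 * q^-1 = q by field.
have q3 : q ^+ 2 * q = q ^+ 3 by ring.
have qV3 : q ^- 2 * q^-1 = q ^- 3 by field.
(* Moving [w] through [a] or [b] costs [q^4], exactly the ratio of the two
   outer weights: this is where the [w] part of [N] disappears. *)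
have cancel (k : K) (u v : A) :
    q ^+ 2 *: (k *: (u - v)) - q ^- 2 *: (k *: (u - q ^+ 4 *: v))
      = ((q ^+ 2 - q ^- 2) * k) *: u.
  rewrite !scalerBr !scalerA [q ^- 2 * k * _]mulrAC qV2q4 opprB addrA subrK.
  by rewrite -scalerBl mulrBl.
split.
  transitivity (q ^+ 2 *: (a * (q *: (a * b) - q^-1 *: (b * a)))
                - q ^- 2 *: ((q *: (a * b) - q^-1 *: (b * a)) * a)).
    rewrite mulrBr mulrBl -!scalerAr -!scalerAl !scalerBr !scalerA.
    rewrite qV2q q2qV q3 qV3 !expr2 !mulrA scalerDl !opprD !opprK.
    by rewrite !addrA.
  rewrite defN -scalerAr -scalerAl mulrBr mulrBl mulr1 mul1r wa.
  exact: cancel.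
transitivity (q ^+ 2 *: ((q *: (a * b) - q^-1 *: (b * a)) * b)
              - q ^- 2 *: (b * (q *: (a * b) - q^-1 *: (b * a)))).
  rewrite mulrBr mulrBl -!scalerAr -!scalerAl !scalerBr !scalerA.
  rewrite qV2q q2qV q3 qV3 !expr2 !mulrA scalerDl !opprD !opprK.
  by rewrite addrC [q ^- 3 *: _ + _]addrC -!addrA.
rewrite defN -scalerAr -scalerAl mulrBr mulrBl mulr1 mul1r bw.
exact: cancel.
Qed.

Lemma nu_cubic_relations x y z : qweyl x y -> qweyl y z -> qweyl z x ->
  let a := nu y z in
  let b := nu z x in
  let c := (q ^+ 2 - q ^- 2) * (q - q^-1) in
  (q ^+ 3 *: (a ^+ 2 * b) - (q + q^-1) *: (a * b * a)
     + q ^- 3 *: (b * a ^+ 2) = c *: a) /\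
  (q ^- 3 *: (b ^+ 2 * a) - (q + q^-1) *: (b * a * b)
     + q ^+ 3 *: (a * b ^+ 2) = c *: b).
Proof.
move=> xy yz zx; apply: (@cubic_relations _ _ (z ^+ 2)).
- exact: nu_qcommutator.
- exact: nu_qcommr2.
- exact: nu_qcomml2.
Qed.

End QCommutation.

Theorem lemma3p9 (K : fieldType) (q : K) (q0 : q != 0) (q2 : q ^+ 2 != 1) :
  let nux : uqsl2 q0 q2 := nu_x q0 q2 in
  let nuy : uqsl2 q0 q2 := nu_y q0 q2 in
  let nuz : uqsl2 q0 q2 := nu_z q0 q2 in
  let c : K := (q ^+ 2 - q ^- 2) * (q - q^-1) in
  (q ^+ 3 *: (nux ^+ 2 * nuy) - (q + q^-1) *: (nux * nuy * nux)
     + q ^- 3 *: (nuy * nux ^+ 2) = c *: nux) /\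
  (q ^+ 3 *: (nuy ^+ 2 * nuz) - (q + q^-1) *: (nuy * nuz * nuy)
     + q ^- 3 *: (nuz * nuy ^+ 2) = c *: nuy) /\
  (q ^+ 3 *: (nuz ^+ 2 * nux) - (q + q^-1) *: (nuz * nux * nuz)
     + q ^- 3 *: (nux * nuz ^+ 2) = c *: nuz) /\
  (q ^- 3 *: (nuy ^+ 2 * nux) - (q + q^-1) *: (nuy * nux * nuy)
     + q ^+ 3 *: (nux * nuy ^+ 2) = c *: nuy) /\
  (q ^- 3 *: (nuz ^+ 2 * nuy) - (q + q^-1) *: (nuz * nuy * nuz)
     + q ^+ 3 *: (nuy * nuz ^+ 2) = c *: nuz) /\
  (q ^- 3 *: (nux ^+ 2 * nuz) - (q + q^-1) *: (nux * nuz * nux)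
     + q ^+ 3 *: (nuz * nux ^+ 2) = c *: nux).
Proof.
move=> nux nuy nuz c.
have [_ _ xy yz zx] := uqsl2_relations q0 q2.
have [xy1 xy2] := nu_cubic_relations q0 q2 xy yz zx.
have [yz1 yz2] := nu_cubic_relations q0 q2 yz zx xy.
have [zx1 zx2] := nu_cubic_relations q0 q2 zx xy yz.
exact (conj xy1 (conj yz1 (conj zx1 (conj xy2 (conj yz2 zx2))))).
Qed.
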